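(* Let $\mathcal{A}$ be a simple maxout arrangement of $m\ge n+1$ maxout units of ranks $k_1,\dots,k_m\ge2$ in $\mathbb{R}^n$. Then $$r(\mathcal{A})=\sum_{j=0}^{n}(-1)^{n-j}\binom{m-1-j}{n-j}\sum_{S\in\binom{[m]}{j}}r(\mathcal{A}_S).$$
   Context: Maxout arrangement in $\mathbb{R}^n$: given $m$ maxout units $z_i(x)=\max\{A_{i,1}(x),\dots,A_{i,k_i}(x)\}$, $x\in\mathbb{R}^n$, with affine functions $A_{i,a}$, the arrangement is $\mathcal{A}=\{H^i_{ab}: i\in[m],\{a,b\}\in\binom{[k_i]}{2},\ \operatorname{codim}H^i_{ab}=1\}$, where $H^i_{ab}=\{x: A_{i,a}(x)=A_{i,b}(x)=\max_{c\in[k_i]}A_{i,c}(x)\}$. Its elements are called atoms. For $S\subseteq[m]$, $\mathcal{A}_S$ is the sub-arrangement of atoms of units $i\in S$ ($\mathcal{A}_\emptyset$ is empty). $r(\mathcal{A})$ is the number of connected components of $\mathbb{R}^n\setminus\bigcup_{H\in\mathcal{A}}H$, so $r(\mathcal{A}_\emptyset)=1$. The arrangement is simple (in general position) if, for every $j$, the intersection of any $j$ atoms of (pairwise) different units is either empty or has codimension $j$ (in particular it is empty for $j>n$). $[m]=\{1,\dots,m\}$ and $\binom{[m]}{j}$ is the set of $j$-element subsets of $[m]$. *)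

(* Defs.v *)
From HB Require Import structures.
From mathcomp Require Import all_boot all_order all_algebra.
From mathcomp Require Import finmap.
From mathcomp Require Import all_classical all_reals all_analysis.

Set Implicit Arguments.
Unset Strict Implicit.
Unset Printing Implicit Defensive.

Import Order.TTheory GRing.Theory Num.Theory.
Import numFieldNormedType.Exports.

Local Open Scope classical_set_scope.
Local Open Scope ring_scope.

Section AffineGeometry.
Variables (R : realType) (n : nat).
Implicit Types X : set 'rV[R]_n.

Definition affine_function (f : 'rV[R]_n -> R) : Prop :=
  exists (w : 'rV[R]_n) (b : R), forall x, f x = \sum_j w 0 j * x 0 j + b.

Definition affine_hull X : set 'rV[R]_n :=
  [set y | exists (p : nat) (x : 'I_p -> 'rV[R]_n) (l : 'I_p -> R),
     [/\ forall i, X (x i), \sum_i l i = 1 & y = \sum_i l i *: x i]].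

(* The codimension of X is that of its affine hull x0 + W.  The affine hull of
   the empty set is empty, so the empty set has no codimension. *)
Definition has_codim X (c : nat) : Prop :=
  exists (x0 : 'rV[R]_n) (W : {vspace 'rV[R]_n}),
    affine_hull X = [set x | x - x0 \in W] /\ (\dim W + c)%N = n.

End AffineGeometry.

Section MaxoutArrangement.
Variables (R : realType) (n m : nat) (k : 'I_m -> nat).
Variable A : forall i : 'I_m, 'I_(k i) -> 'rV[R]_n -> R.

(* Seeding the maximum with A i a x, itself one of the terms, makes it the
   maximum over c < k i. *)
Definition maxout_face (i : 'I_m) (a b : 'I_(k i)) : set 'rV[R]_n :=
  [set x | A a x = A b x /\ A b x = \big[Num.max/A a x]_(c < k i) A c x].

Definition unit_atoms (i : 'I_m) : set (set 'rV[R]_n) :=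
  [set H | exists a b : 'I_(k i),
     [/\ a != b, H = maxout_face a b & has_codim H 1]].

(* The sub-arrangement of the units in S; S = setT is the whole arrangement. *)
Definition arrangement (S : {set 'I_m}) : set (set 'rV[R]_n) :=
  \bigcup_(i in [set` S]) unit_atoms i.

(* Atoms are indexed by their unit: if distinct units share an atom, it counts
   once for each of them. *)
Definition simple_arrangement : Prop :=
  forall (S : {set 'I_m}) (H : 'I_m -> set 'rV[R]_n),
    (forall i, i \in S -> unit_atoms i (H i)) ->
    \bigcap_(i in [set` S]) H i = set0 \/
    has_codim (\bigcap_(i in [set` S]) H i) #|S|.

End MaxoutArrangement.

Section Regions.
Variables (R : realType) (n : nat).
Implicit Type AA : set (set 'rV[R]_n).

Definition arrangement_compl AA : set 'rV[R]_n := ~` \bigcup_(H in AA) H.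

Definition regions AA : set (set 'rV[R]_n) :=
  connected_component (arrangement_compl AA) @` arrangement_compl AA.

(* fset_set is empty on infinite sets.  A maxout arrangement has finitely many
   regions, since they are separated by which affine piece attains the maximum
   in each unit. *)
Definition num_regions AA : nat := #|` fset_set (regions AA)|.

End Regions.

(* Main.v *)
Require Import Defs.
From HB Require Import structures.
From mathcomp Require Import all_boot all_order all_algebra.
From mathcomp Require Import finmap.
From mathcomp Require Import all_classical all_reals all_analysis.
From mathcomp Require Import ring lra zify.

Set Implicit Arguments.
Unset Strict Implicit.
Unset Printing Implicit Defensive.

Import Order.TTheory GRing.Theory Num.Theory.
Import numFieldNormedType.Exports.

Local Open Scope classical_set_scope.
Local Open Scope ring_scope.

(* The differences of the affine pieces of all units cut R^n into relatively
   open cells; give a cell the weight (-1)^codim.  By additivity of the Euler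
   characteristic, the weights of the cells inside a nonempty open convex union
   of cells sum to 1.  Every region of A_S is such a union, so
     r(A_S) = sum over cells c of w(c) [S is disjoint from act(c)],
   where act(c) is the set of units whose maximum bends on c.  The bending locus
   of a unit is the union of its atoms, hence general position gives
   |act(c)| <= n, and the formula reduces, cell by cell, to the binomial identity
     sum_(j <= n) (-1)^(n-j) C(m-1-j, n-j) C(u, j) = [u = m]   (m - n <= u <= m),
   which is the coefficient of x^n in (1 + x)^-(m-n) (1 + x)^u. *)

(** * Convexity and openness along lines *)

Section EulerCharacteristic.
Variables (R : realFieldType) (V : lmodType R).
Implicit Types (f g h : V -> R) (P Q : set V).

Definition affine f := forall x v t, f (x + t *: v) = f x + t * (f (x + v) - f x).

Lemma affine_segment f x y t :
  affine f -> f (x + t *: (y - x)) = f x + t * (f y - f x).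
Proof. by move=> ->; rewrite (addrC x) subrK. Qed.

Lemma affineB f g : affine f -> affine g -> affine (fun x => f x - g x).
Proof. by move=> af ag x v t; rewrite af ag; ring. Qed.

Lemma affineZ a f : affine f -> affine (fun x => a * f x).
Proof. by move=> af x v t; rewrite af; ring. Qed.

Definition seg_convex Q :=
  forall x y t, Q x -> Q y -> 0 <= t <= 1 -> Q (x + t *: (y - x)).

Definition alg_open Q :=
  forall x v, Q x -> exists2 e, 0 < e & forall t, 0 <= t <= e -> Q (x + t *: v).

(** For convex sets in finite dimension this is openness in the affine hull, the form of openness
    that lower-dimensional cells retain. *)
Definition relatively_open Q :=
  forall x y, Q x -> Q y -> exists2 e, 0 < e & Q (x - e *: (y - x)).

Lemma alg_openI P Q : alg_open P -> alg_open Q -> alg_open (P `&` Q).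
Proof.
move=> oP oQ x v [Px Qx].
have [e e0 He] := oP x v Px; have [d d0 Hd] := oQ x v Qx.
exists (Num.min e d); first by rewrite lt_min e0.
by move=> t; rewrite le_min => /and3P[t0 te td]; split; [apply: He|apply: Hd]; rewrite t0.
Qed.

Lemma alg_open_pos f : affine f -> alg_open [set x | 0 < f x].
Proof.
move=> af x v /= fx.
set d := f (x + v) - f x.
have D0 : 0 < 1 + `|d| by rewrite ltr_pwDl.
(* The summand 1 keeps the denominator positive when [d = 0] and the inequality strict at the right
   end point. *)
exists (f x / (1 + `|d|)) => [|t /andP[t0 te]]; first exact: divr_gt0.
rewrite af -/d.
have : t * (1 + `|d|) <= f x by rewrite -ler_pdivlMr.
have [->|tn0] := eqVneq t 0; first by rewrite !mul0r addr0.
have tp : 0 < t by rewrite lt_def tn0.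
have : - d <= `|d| by rewrite -normrN ler_norm.
nra.
Qed.

Lemma alg_open_neg f : affine f -> alg_open [set x | f x < 0].
Proof.
move=> /(affineZ (-1)) /alg_open_pos.
by congr alg_open; apply/seteqP; split=> x /=; rewrite mulN1r oppr_gt0.
Qed.

Lemma alg_open_neq0 f : affine f -> alg_open [set x | f x != 0].
Proof.
move=> af x v /=; rewrite neq_lt => /orP[fx|fx].
  by have [e e0 He] := alg_open_neg af v fx; exists e => // t /He /= /ltr0_neq0.
by have [e e0 He] := alg_open_pos af v fx; exists e => // t /He /= /lt0r_neq0.
Qed.

Lemma alg_open_forall (I : finType) (Q : I -> set V) :
  (forall i, alg_open (Q i)) -> alg_open [set x | forall i, Q i x].
Proof.
move=> oQ x v Qx.
have H i : exists e, 0 < e /\ forall t, 0 <= t <= e -> Q i (x + t *: v).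
  by have [e e0 He] := oQ i x v (Qx i); exists e.
have /choice[e He] := H.
exists (\big[Num.min/1]_i e i).
  by apply/bigmin_gtP; split=> // i _; have [] := He i.
move=> t /andP[t0 te] i; apply: (He i).2; rewrite t0 /=.
by apply: le_trans te _; exact: bigmin_le_cond.
Qed.

Lemma alg_open_impl (B : Prop) Q : (B -> alg_open Q) -> alg_open [set x | B -> Q x].
Proof.
move=> oQ x v Qx; have [b|nb] := pselect B; last by exists 1 => // t _ /nb.
have [e e0 He] := oQ b x v (Qx b); by exists e => // t /He Qt _.
Qed.

(** If [F i] vanishes at the current point, a short step towards a point where it does not makes it
    nonzero; the open condition [F i x != 0] then joins [Q] before the next function is treated. *)
Lemma generic_point (I : finType) (F : I -> V -> R) Q :
  (forall i, affine (F i)) -> alg_open Q -> Q !=set0 ->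
  exists2 y, Q y & forall i, (exists x, F i x != 0) -> F i y != 0.
Proof.
move=> aF oQ Q0; suff [y Qy Hy] : exists2 y, Q y &
    forall i, i \in enum I -> (exists x, F i x != 0) -> F i y != 0.
  by exists y => // i; apply: Hy; rewrite mem_enum.
elim: (enum I) Q oQ Q0 => [|i s IH] Q oQ [x Qx]; first by exists x.
have [[z Fz]|nF] := pselect (exists z, F i z != 0); last first.
  have [|y Qy Hy] := IH Q oQ; first by exists x.
  by exists y => // j; rewrite inE => /predU1P[->//|]; exact: Hy.
have [||y [Qy Fy] Hy] := IH (Q `&` [set x | F i x != 0]).
- exact: (alg_openI oQ (alg_open_neq0 (aF i))).
- have [Fx|Fx] := eqVneq (F i x) 0; last by exists x.
  have [e e0 He] := oQ x (z - x) Qx.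
  exists (x + e *: (z - x)); split=> /=; first by apply: He; rewrite lexx ltW.
  by rewrite affine_segment// Fx add0r subr0 mulf_neq0// gt_eqF.
by exists y => // j; rewrite inE => /predU1P[->//|]; exact: Hy.
Qed.

Definition cut_by h P := (exists2 x, P x & 0 < h x) /\ (exists2 x, P x & h x < 0).

(** * Signed cell decompositions *)

Section Cells.
Variables (I : eqType) (F : I -> V -> R).
Hypothesis aF : forall i, affine (F i).

(* The weight of a cell is (-1)^codim: it changes sign each time a hyperplane
   properly cuts the current cell.  The base case picks a sample point; it is
   meaningful only for nonempty [P]. *)
Fixpoint weighted_cells (s : seq I) (w : int) P : seq (int * V) :=
  if s isn't i :: s' then [:: (w, xget 0 P)] else
  if `[< cut_by (F i) P >] then
    weighted_cells s' w (P `&` [set x | 0 < F i x]) ++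
    weighted_cells s' w (P `&` [set x | F i x < 0]) ++
    weighted_cells s' (- w) (P `&` [set x | F i x = 0])
  else weighted_cells s' w P.

(** Testing the sample point stands for containment of the whole cell, as the sets [Q] of interest
    are unions of cells. *)
Definition weighted_count (L : seq (int * V)) Q : int :=
  \sum_(c <- L) c.1 * (c.2 \in Q)%:R.

Lemma seg_convexI P Q : seg_convex P -> seg_convex Q -> seg_convex (P `&` Q).
Proof. by move=> cP cQ x y t [Px Qx] [Py Qy] tI; split; [apply: cP|apply: cQ]. Qed.

Lemma seg_convex_pos f : affine f -> seg_convex [set x | 0 < f x].
Proof. by move=> af x y t /= fx fy /andP[t0 t1]; rewrite affine_segment//; nra. Qed.

Lemma seg_convex_neg f : affine f -> seg_convex [set x | f x < 0].
Proof. by move=> af x y t /= fx fy /andP[t0 t1]; rewrite affine_segment//; nra. Qed.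

Lemma seg_convex_zero f : affine f -> seg_convex [set x | f x = 0].
Proof. by move=> af x y t /= fx fy _; rewrite affine_segment// fx fy; ring. Qed.

Lemma relatively_openI_alg_open P Q :
  seg_convex P -> relatively_open P -> alg_open Q -> relatively_open (P `&` Q).
Proof.
move=> cP rP oQ x y [Px Qx] [Py _].
have [e e0 He] := rP x y Px Py; have [d d0 Hd] := oQ x (x - y) Qx.
have m0 : 0 < Num.min e d by rewrite lt_min e0.
exists (Num.min e d) => //; split; last first.
  by rewrite -scalerN opprB; apply: Hd; rewrite ltW// ge_min lexx orbT.
have -> : x - Num.min e d *: (y - x) =
          x + (Num.min e d / e) *: ((x - e *: (y - x)) - x).
  by rewrite (addrAC x _ (- x)) subrr add0r scalerN scalerA divfK// gt_eqF.
by apply: cP => //; rewrite ltW ?divr_gt0//= ler_pdivrMr// mul1r ge_min lexx.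
Qed.

Lemma relatively_openI_zero P f :
  affine f -> relatively_open P -> relatively_open (P `&` [set x | f x = 0]).
Proof.
move=> af rP x y [Px fx] [Py fy]; have [e e0 He] := rP x y Px Py.
exists e => //; split=> //=; rewrite -scaleNr affine_segment// fx fy; ring.
Qed.

(** If [h] vanished at [u] but not at [v], prolonging the segment from [v] beyond [u] would reach
    the opposite sign, and [h] would cut [P]. So [h] vanishes everywhere or nowhere on [P]. *)
Lemma uncut_constant_sign P h x y : relatively_open P -> affine h ->
  ~ cut_by h P -> P x -> P y -> Num.sg (h x) = Num.sg (h y).
Proof.
move=> rP ah ncut.
have zero u v : P u -> P v -> h u = 0 -> h v = 0.
  move=> Pu Pv hu; have [e e0 He] := rP u v Pu Pv.
  have := affine_segment u v (- e) ah; rewrite scaleNr hu subr0 add0r => Ez.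
  have [hv|hv|//] := ltgtP (h v) 0; exfalso; apply: ncut; split.
  - by exists (u - e *: (v - u)) => //; rewrite Ez; nra.
  - by exists v.
  - by exists v.
  - by exists (u - e *: (v - u)) => //; rewrite Ez; nra.
move=> Px Py; have [hx|hx|hx] := ltgtP (h x) 0; last by rewrite hx (zero x y).
- have [hy|hy|hy] := ltgtP (h y) 0; first by rewrite !ltr0_sg.
    by exfalso; apply: ncut; split; [exists y|exists x].
  by move: hx; rewrite (zero y x)// ltxx.
- have [hy|hy|hy] := ltgtP (h y) 0; last by move: hx; rewrite (zero y x)// ltxx.
    by exfalso; apply: ncut; split; [exists x|exists y].
  by rewrite !gtr0_sg.
Qed.

Lemma cut_by_zero P h : seg_convex P -> affine h -> cut_by h P ->
  exists2 x, P x & h x = 0.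
Proof.
move=> cP ah [[x Px hx] [y Py hy]].
have D0 : 0 < h x - h y by lra.
exists (x + (h x / (h x - h y)) *: (y - x)).
  by apply: cP => //; rewrite ltW ?divr_gt0//= ler_pdivrMr// mul1r lerDl oppr_ge0 ltW.
by rewrite affine_segment//; field; rewrite gt_eqF.
Qed.

Lemma weighted_count_cat L1 L2 Q :
  weighted_count (L1 ++ L2) Q = weighted_count L1 Q + weighted_count L2 Q.
Proof. exact: big_cat. Qed.

(** Sample points lie in [P], hence outside [Q]. Nonemptiness is carried along because the default
    value of [xget] might lie in [Q]. *)
Lemma weighted_cells_disjoint s w P Q :
  seg_convex P -> P !=set0 ->
  P `&` Q = set0 -> weighted_count (weighted_cells s w P) Q = 0.
Proof.
elim: s w P => [|i s IH] w P cP [x0 Px0] PQ /=.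
  rewrite /weighted_count big_seq1 /= memNset ?mulr0// => Qx.
  have Px : P (xget 0 P) by apply: xgetPex; exists x0.
  by have : (P `&` Q) (xget 0 P) by []; rewrite PQ.
have ah := aF i; set h := F i in ah *.
case: asboolP => cut; last by apply: IH => //; exists x0.
have sub S : P `&` S `&` Q = set0 by rewrite setIAC PQ set0I.
have [z Pz hz] := cut_by_zero cP ah cut.
case: cut => -[x Px hx] [y Py hy].
rewrite !weighted_count_cat !IH ?addr0//.
- exact: (seg_convexI cP (seg_convex_zero ah)).
- by exists z.
- exact: (seg_convexI cP (seg_convex_neg ah)).
- by exists y.
- exact: (seg_convexI cP (seg_convex_pos ah)).
- by exists x.
Qed.

(* Additivity of the Euler characteristic, specialised to a convex [Q] that is
   a union of cells: cutting [Q] by a hyperplane replaces w by w + w - w. *)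
Lemma weighted_cells_convex s w P Q :
  seg_convex P -> relatively_open P ->
  seg_convex Q -> alg_open Q -> P `&` Q !=set0 ->
  (forall x y, P x -> P y ->
     {in s, forall i, Num.sg (F i x) = Num.sg (F i y)} -> Q x -> Q y) ->
  weighted_count (weighted_cells s w P) Q = w.
Proof.
elim: s w P => [|i s IH] w P cP rP cQ oQ [x0 [Px0 Qx0]] det /=.
  rewrite /weighted_count big_seq1 /= mem_set ?mulr1//.
  by apply: (det x0) => //; apply: xgetPex; exists x0.
have ah := aF i; set h := F i in ah *.
case: asboolP => cut; last first.
  apply: IH => //; first by exists x0.
  move=> x y Px Py sg_xy; apply: det => // j; rewrite inE => /predU1P[->|]; last exact: sg_xy.
  exact: (uncut_constant_sign rP ah cut).
have [z Pz hz] := cut_by_zero cP ah cut.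
have [[x Px hx] [y Py hy]] := cut.
have det_sub S : (forall a b, S a -> S b -> Num.sg (h a) = Num.sg (h b)) ->
    forall a b, (P `&` S) a -> (P `&` S) b ->
    {in s, forall j, Num.sg (F j a) = Num.sg (F j b)} -> Q a -> Q b.
  move=> sgS a b [Pa Sa] [Pb Sb] sg_ab.
  by apply: det => // j; rewrite inE => /predU1P[->|]; [exact: sgS|exact: sg_ab].
have cPp := seg_convexI cP (seg_convex_pos ah).
have cPn := seg_convexI cP (seg_convex_neg ah).
have cPz := seg_convexI cP (seg_convex_zero ah).
rewrite !weighted_count_cat.
have one w' S : seg_convex (P `&` S) -> relatively_open (P `&` S) ->
    (forall a b, S a -> S b -> Num.sg (h a) = Num.sg (h b)) ->
    (exists2 u, (P `&` Q) u & S u) ->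
    weighted_count (weighted_cells s w' (P `&` S)) Q = w'.
  move=> cS rS sgS [u [Pu Qu] Su].
  by apply: IH => //; [exists u|exact: det_sub].
have zero w' S : seg_convex (P `&` S) -> P `&` S !=set0 ->
    ~ (exists2 u, (P `&` Q) u & S u) ->
    weighted_count (weighted_cells s w' (P `&` S)) Q = 0.
  move=> cS nS nQ; apply: weighted_cells_disjoint => //.
  by apply/seteqP; split=> // u [[Pu Su] Qu]; apply: nQ; exists u.
have rp := relatively_openI_alg_open cP rP (alg_open_pos ah).
have rn := relatively_openI_alg_open cP rP (alg_open_neg ah).
have rz := relatively_openI_zero ah rP.
have sp a b : 0 < h a -> 0 < h b -> Num.sg (h a) = Num.sg (h b).
  by move=> ? ?; rewrite !gtr0_sg.
have sn a b : h a < 0 -> h b < 0 -> Num.sg (h a) = Num.sg (h b).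
  by move=> ? ?; rewrite !ltr0_sg.
have sz a b : h a = 0 -> h b = 0 -> Num.sg (h a) = Num.sg (h b).
  by move=> -> ->.
have np : P `&` [set x | 0 < h x] !=set0 by exists x.
have nn : P `&` [set x | h x < 0] !=set0 by exists y.
have nz : P `&` [set x | h x = 0] !=set0 by exists z.
have cPQ := seg_convexI cP cQ.
(* If [h] cuts the intersection of [P] and [Q], all three pieces count; otherwise [h] has constant
   sign there and exactly one piece meets [Q]. *)
have [cutQ|ncutQ] := pselect (cut_by h (P `&` Q)).
  have [u PQu hu] := cut_by_zero cPQ ah cutQ.
  have [p n] := cutQ.
  rewrite (one _ _ cPp rp sp p) (one _ _ cPn rn sn n) (one _ _ cPz rz sz); first lia.
  by exists u.
have sgQ a : (P `&` Q) a -> Num.sg (h a) = Num.sg (h x0).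
  move=> PQa; apply: (uncut_constant_sign _ ah ncutQ) => //.
  exact: relatively_openI_alg_open.
have [hx0|hx0|hx0] := ltgtP (h x0) 0.
- rewrite (one _ _ cPn rn sn); last by exists x0.
  rewrite (zero _ _ cPp np) ?(zero _ _ cPz nz) ?add0r ?addr0// => -[u /sgQ].
    by rewrite (ltr0_sg hx0) => Eu /= hu; move: Eu; rewrite hu sgr0; lra.
  by rewrite (ltr0_sg hx0) => Eu /= hu; move: Eu; rewrite (gtr0_sg hu); lra.
- rewrite (one _ _ cPp rp sp); last by exists x0.
  rewrite (zero _ _ cPn nn) ?(zero _ _ cPz nz) ?add0r ?addr0// => -[u /sgQ].
    by rewrite (gtr0_sg hx0) => Eu /= hu; move: Eu; rewrite hu sgr0; lra.
  by rewrite (gtr0_sg hx0) => Eu /= hu; move: Eu; rewrite (ltr0_sg hu); lra.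
- (* [Q] is open at [x0], so it contains a point towards [x], where h > 0. *)
  have [e e0 He] := oQ x0 (x - x0) Qx0.
  pose t := Num.min e 1.
  have t0 : 0 < t by rewrite lt_min e0 ltr01.
  have /sgQ : (P `&` Q) (x0 + t *: (x - x0)).
    split; first by apply: cP => //; rewrite ltW//= ge_min lexx orbT.
    by apply: He; rewrite ltW//= ge_min lexx.
  rewrite affine_segment// hx0 sgr0 add0r subr0 gtr0_sg ?mulr_gt0//.
  by move/eqP; rewrite oner_eq0.
Qed.

End Cells.

End EulerCharacteristic.

(** * Topology of regions *)

Section AffineTopology.
Variables (R : realType) (n : nat).
Implicit Types (f g : 'rV[R]_n -> R) (Q : set 'rV[R]_n).

Lemma affine_function_affine f : affine_function f -> affine f.
Proof.
move=> [w [b Ef]] x v t; rewrite !Ef.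
have E y s : \sum_j w 0 j * (x + s *: y) 0 j =
    \sum_j w 0 j * x 0 j + s * \sum_j w 0 j * y 0 j.
  rewrite mulr_sumr -big_split; apply: eq_bigr => j _ /=.
  by rewrite !mxE mulrDr mulrCA.
rewrite E; have := E v 1; rewrite scale1r => ->; ring.
Qed.

Lemma affine_functionB f g : affine_function f -> affine_function g ->
  affine_function (fun x => f x - g x).
Proof.
move=> [w [b Ef]] [v [c Eg]]; exists (w - v), (b - c) => x.
rewrite Ef Eg opprD addrACA -sumrB; congr (_ + _).
by apply: eq_bigr => j _; rewrite !mxE mulrBl.
Qed.

Lemma affine_function_continuous f : affine_function f -> continuous f.
Proof.
move=> [w [b Ef]]; have -> : f = fun y => \sum_j w 0 j * y 0 j + b by exact/funext.
have gen (T : topologicalType) (g : 'I_n -> T -> R) : (forall j, continuous (g j)) ->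
    continuous (fun y => \sum_j w 0 j * g j y + b).
  move=> cg x; apply: cvgD; last exact: cvg_cst.
  apply: cvg_big => [|j _]; first exact: add_continuous.
  by apply: cvgM; [exact: cvg_cst|exact: cg].
by apply: (gen _ (fun j (y : 'rV[R]_n) => y 0 j)) => j; exact: coord_continuous.
Qed.

Lemma open_affine_pos f : affine_function f -> open [set x | 0 < f x].
Proof.
move=> af; apply: (@open_comp _ _ f [set y | 0 < y]) => [x _|].
  exact: affine_function_continuous.
exact: open_gt.
Qed.

Lemma closed_affine_ge0 f : affine_function f -> closed [set x | 0 <= f x].
Proof.
move=> af; apply: (@preimage_closed _ _ f [set y | 0 <= y]) => [x _|].
  exact: affine_function_continuous.
exact: closed_ge.
Qed.

Lemma line_continuous (x v : 'rV[R]_n) : continuous (fun t : R => x + t *: v).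
Proof.
move=> t A [P xP PA].
suff : \forall s \near t, forall i j, P i j ((x + s *: v) i j) by apply: filterS => s /PA.
apply: (@filter_forall _ _ (fun i => [set s | forall j, P i j ((x + s *: v) i j)]) (nbhs t) _) => a.
apply: (@filter_forall _ _ (fun j => [set s | P a j ((x + s *: v) a j)]) (nbhs t) _) => a0.
have : continuous (fun s : R => x a a0 + s * v a a0).
  move=> s; apply: cvgD; first exact: cvg_cst.
  by apply: cvgM; [exact: cvg_id|exact: cvg_cst].
move=> /(_ t); have := xP a a0; rewrite !mxE => Pa /(_ _ Pa).
by apply: (@filterS _ (nbhs t)) => s /=; rewrite !mxE.
Qed.

Lemma seg_convex_connected Q : seg_convex Q -> connected Q.
Proof.
move=> cQ; have [[x Qx]|/set0P/negP/negPn/eqP->] := pselect (Q !=set0); last first.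
  exact: connected0.
have -> : Q = \bigcup_(y in Q) [set x + t *: (y - x) | t in `[0, 1]].
  apply/seteqP; split=> z.
    by move=> Qz; exists z => //; exists 1; rewrite /= ?in_itv/= ?lexx ?ler01// scale1r addrC subrK.
  by move=> [y Qy [t +] <-]; rewrite /= in_itv/= => tI; exact: cQ.
apply: bigcup_connected => [|y Qy].
  by exists x => y Qy; exists 0; rewrite /= ?in_itv/= ?lexx ?ler01// scale0r addr0.
apply: connected_continuous_connected; first exact: segment_connected.
by apply: continuous_subspaceT; exact: line_continuous.
Qed.

(** The trace of [Q] on the component of [x] is nonempty, open and closed there, so it is the whole
    component. *)
Lemma connected_component_clopen (C Q O F : set 'rV[R]_n) x :
  connected Q -> Q x -> open O -> closed F -> C `&` O = Q -> C `&` F = Q ->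
  connected_component C x = Q.
Proof.
move=> conQ Qx oO cF CO CF; have QC : Q `<=` C by rewrite -CO; exact: subIsetl.
apply/seteqP; split; last exact: connected_component_max.
set D := connected_component C x; have DC : D `<=` C := @connected_component_sub _ C x.
have Dx : D x by apply: connected_component_refl; exact: QC.
suff <- : D `&` Q = D by exact: subIsetr.
apply: (component_connected (A := C) (x := x)).
- by exists x.
- by exists O => //; rewrite -CO setIA; congr (_ `&` _); exact/setIidPl.
- by exists F => //; rewrite -CF setIA; congr (_ `&` _); exact/setIidPl.
Qed.

(** The components partition the complement, and each contributes 1 to its weighted count. *)
Lemma num_regions_weighted (AA : set (set 'rV[R]_n)) (L : seq (int * 'rV[R]_n)) :
  (forall x, arrangement_compl AA x ->
     weighted_count L (connected_component (arrangement_compl AA) x) = 1) ->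
  (num_regions AA)%:Z = weighted_count L (arrangement_compl AA).
Proof.
rewrite /num_regions /regions; set C := arrangement_compl AA => H.
set RR := _ @` C.
(* A region of count 1 contains a sample point, so there are finitely many regions; otherwise
   [fset_set] would be empty. *)
have finRR : finite_set RR.
  apply: (sub_finite_set _ (finite_seq [seq connected_component C c.2 | c <- L])).
  move=> _ [x Cx <-] /=.
  have [/hasP[c cL /set_mem cx]|/hasPn nL] :=
      boolP (has (fun c => c.2 \in connected_component C x) L).
    by rewrite (same_connected_component cx); apply/mapP; exists c.
  have := H x Cx; rewrite /weighted_count big_seq_cond big1 => [/esym/eqP|c].
    by rewrite oner_eq0.
  by rewrite andbT => /nL/negbTE ->; rewrite mulr0.
have inRR Q : (Q \in fset_set RR) = `[< RR Q >].
  by rewrite in_fset_set// -[RHS]/(Q \in RR).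
have count1 y : (y \in C)%:R = \sum_(Q <- fset_set RR) (y \in Q)%:R :> int.
  have [/set_mem Cy|nCy] := boolP (y \in C).
    rewrite (bigD1_seq (connected_component C y)) ?fset_uniq//=; last first.
      by rewrite inRR; apply/asboolP; exists y.
    rewrite mem_set ?big1_seq ?addr0//; last exact: connected_component_refl.
    move=> Q /andP[/negP nQ]; rewrite inRR => /asboolP[x Cx EQ].
    rewrite memNset// => Qy; apply: nQ; apply/eqP; rewrite -EQ.
    by apply: same_connected_component; rewrite EQ.
  rewrite big1_seq// => Q /=; rewrite inRR => /asboolP[x Cx <-].
  rewrite memNset// => /connected_component_sub Cy.
  by move/negP: nCy; apply; exact: mem_set.
rewrite /weighted_count; under eq_bigr do rewrite count1 mulr_sumr.
rewrite exchange_big/= (eq_big_seq (fun=> 1)) => [|Q]; last first.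
  by rewrite inRR => /asboolP[x Cx <-]; exact: H.
by rewrite big_const_seq count_predT iter_addr_0 natz.
Qed.

End AffineTopology.

(** * The bending locus of a maximum of affine functions *)

Section Bend.
Variables (R : realFieldType) (V : lmodType R) (k : nat) (f : 'I_k -> V -> R).
Hypothesis af : forall a, affine (f a).

Definition is_max x a := forall c, f c x <= f a x.

(* The locus where the maximum of the [f a] fails to be locally affine; pieces
   with equal functions are identified. *)
Definition bend : set V :=
  [set x | exists a b, [/\ f a <> f b, f a x = f b x & is_max x a]].

Lemma alg_open_lt (a b : 'I_k) : alg_open [set x | f a x < f b x].
Proof.
have := alg_open_pos (affineB (af b) (af a)).
by congr alg_open; apply/seteqP; split=> x /=; rewrite subr_gt0.
Qed.

Lemma seg_convex_lt (a b : 'I_k) : seg_convex [set x | f a x < f b x].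
Proof.
have := seg_convex_pos (affineB (af b) (af a)).
by congr seg_convex; apply/seteqP; split=> x /=; rewrite subr_gt0.
Qed.

Lemma exists_max x (a0 : 'I_k) : exists a, is_max x a.
Proof.
have [a _ Ha] := Order.TotalTheory.arg_maxP (fun a => f a x) (erefl (xpredT a0)).
by exists a => c; exact: Ha.
Qed.

(** An algebraic neighbourhood of [x] in which only ties at [x] can be broken. *)
Definition keep_order x : set V := [set y | forall c a, f c x < f a x -> f c y < f a y].

Lemma alg_open_keep_order x : alg_open (keep_order x).
Proof.
apply: alg_open_forall => c; apply: alg_open_forall => a.
by apply: alg_open_impl => _; exact: alg_open_lt.
Qed.

(* A generic segment leaving the linear region of [p] near [x] crosses its
   boundary in the relative interior of a facet: at the exit point [y], all the
   functions that tie with [p] have proportional differences with [f p]. *)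
Lemma bend_facet x : bend x -> exists p q, [/\ f p <> f q, f p x = f q x, is_max x p &
  exists y, [/\ f p y = f q y, is_max y p & forall d, f d y = f p y ->
    forall z, f p z = f q z -> f d z = f p z]].
Proof.
move=> [a0 [b0 [ab0 E0 max0]]].
have oB := alg_open_keep_order (x := x).
have Bx : keep_order x x by [].
(* At [u] any two pieces that differ as functions have different values, so the maximum is attained
   by a single function. *)
have [|||u Bu Hu] := @generic_point _ _ _ (fun cd z => f cd.1 z - f cd.2 z) (keep_order x).
- by move=> cd; exact: affineB.
- exact: oB.
- by exists x.
have {}Hu c d : f c <> f d -> f c u != f d u.
  move=> cd; rewrite -subr_eq0; apply: (Hu (c, d)) => /=; apply: contrapT => nex.
  apply: cd; apply/funext => z; apply/eqP; rewrite -subr_eq0; apply/negPn/negP => ?.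
  by apply: nex; exists z.
have [p maxu] := exists_max u a0.
have maxx : is_max x p.
  move=> c; rewrite (le_trans (max0 c))// leNgt; apply/negP => /Bu.
  by rewrite ltNge maxu.
have pu c : f c <> f p -> f c u < f p u by move=> /Hu cp; rewrite lt_def eq_sym cp maxu.
have [c0 c0p c0x] : exists2 c0, f c0 <> f p & f c0 x = f p x.
  have pa : f p x = f a0 x by apply/eqP; rewrite eq_le max0 maxx.
  have [ap|ap] := pselect (f a0 = f p); last by exists a0.
  by exists b0; [rewrite -ap => /esym|rewrite pa].
(* [D (c, d) z] is the determinant of the values of [f p - f c] and [f p - f d] at [u] and [z]. It
   is zero at [w] if both differences vanish at a common point of the line through [u] and [w]; by
   the choice of [w] it is then identically zero. *)
pose D (cd : 'I_k * 'I_k) z :=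
  (f p u - f cd.1 u) * (f p z - f cd.2 z) - (f p u - f cd.2 u) * (f p z - f cd.1 z).
have [|||w [Bw /= wc0] Hw] := @generic_point _ _ _ D
    (keep_order x `&` [set z | f p z < f c0 z]).
- by move=> cd; apply: affineB; apply: affineZ; exact: affineB.
- exact: (alg_openI oB (@alg_open_lt p c0)).
(* Just beyond [x] on the line from [u], the piece [c0] overtakes [p]: they tie at [x], and [p] is
   above at [u]. *)
- have [e e0 He] := oB x (- (u - x)) Bx.
  exists (x + e *: - (u - x)); split=> /=; first by apply: He; rewrite lexx ltW.
  rewrite scalerN -scaleNr !affine_segment// c0x ltrD2l.
  by have := pu _ c0p; nra.
pose g c z := f p z - f c z.
have gneg c : g c w < 0 -> 0 < g c u.
  move=> gcw; rewrite subr_gt0; apply: pu => cp.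
  by move: gcw; rewrite /g cp subrr ltxx.
(* The parameter at which [f c] catches up with [f p] between [u] and [w]; the minimiser [q] marks
   the exit from the region of [p]. *)
pose t c := g c u / (g c u - g c w).
have [|q gqw tmin] := @Order.TotalTheory.arg_minP _ _ _ c0 (fun c => g c w < 0) t.
  by rewrite subr_lt0.
have gqu := gneg q gqw.
have D0 : 0 < g q u - g q w by lra.
have t0 : 0 < t q by rewrite divr_gt0.
have t1 : t q <= 1 by rewrite ler_pdivrMr// mul1r; lra.
pose y := u + t q *: (w - u).
have gy c : g c y = g c u + t q * (g c w - g c u).
  by rewrite /g /y (affine_segment _ _ _ (af p)) (affine_segment _ _ _ (af c)); ring.
have gqy : g q y = 0 by rewrite gy /t; field; rewrite gt_eqF.
have maxy : is_max y p.
  move=> c; rewrite -subr_ge0 -/(g c y) gy.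
  have gcu : 0 <= g c u by rewrite subr_ge0.
  have [gcw|gcw] := ltP (g c w) 0; last by nra.
  have gcu0 := gneg c gcw; have Dc0 : 0 < g c u - g c w by lra.
  have := tmin c gcw; rewrite {2}/t ler_pdivlMr//; lra.
(* By convexity [y] stays in [keep_order x], so the tie of [p] and [q] at [y] is already a tie at
   [x]. *)
have By : keep_order x y.
  move=> c a ca; apply: seg_convex_lt; [exact: Bu|exact: Bw|].
  by rewrite ltW.
have fqy : f p y = f q y by apply/eqP; rewrite -subr_eq0 -/(g q y) gqy.
exists p, q; split => //.
- by move=> pq; move: gqu; rewrite /g pq subrr ltxx.
- apply/eqP; rewrite eq_le maxx andbT leNgt; apply/negP => /By.
  by rewrite fqy ltxx.
exists y; split=> // d dy z pqz.
have [->//|dp] := pselect (f d = f p).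
have gdy : g d u + t q * (g d w - g d u) = 0 by rewrite -gy /g dy subrr.
have Dw : D (q, d) w = 0.
  move: gqy; rewrite gy => gqy; apply: (mulfI (lt0r_neq0 t0)); rewrite mulr0.
  transitivity (g q u * (g d u + t q * (g d w - g d u)) -
                g d u * (g q u + t q * (g q w - g q u))); first by rewrite /D /g /=; ring.
  by rewrite gdy gqy !mulr0 subrr.
have Dz : D (q, d) z = 0.
  apply/eqP/negPn/negP => Dz; have /eqP := Hw (q, d) (ex_intro _ z Dz).
  exact.
move: Dz; rewrite /D /= pqz subrr mulr0 subr0 => /eqP; rewrite mulf_eq0.
by rewrite (gt_eqF gqu)/= subr_eq0 => /eqP <-.
Qed.

End Bend.

(** * Affine hulls and codimension one *)

Section Codimension.
Variables (R : realType) (n : nat).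
Implicit Types (g : 'rV[R]_n -> R) (X : set 'rV[R]_n).

Lemma dimv_rV p : \dim {:'rV[R]_p} = p.
Proof. by rewrite dimvf dim_matrix; exact: mul1n. Qed.

Lemma affine_hull_segment X y z e :
  0 < e -> X y -> X (y + e *: (z - y)) -> affine_hull X z.
Proof.
move=> e0 Xy Xe; have ne0 : e != 0 by rewrite gt_eqF.
exists 2%N, (fun i => if i == 0 then y else y + e *: (z - y)),
  (fun i => if i == 0 then 1 - e^-1 else e^-1); split.
- by move=> i; case: ifP.
- by rewrite !big_ord_recl big_ord0 /= addr0 subrK.
rewrite !big_ord_recl big_ord0 /= addr0 scalerDr scalerA mulVf// scale1r.
by rewrite addrA -scalerDl subrK scale1r addrC subrK.
Qed.

Lemma affine_hull_zero X g :
  affine_function g -> X `<=` [set x | g x = 0] -> affine_hull X `<=` [set x | g x = 0].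
Proof.
move=> [w [b Eg]] X0 _ [p [x [l [Xx l1 ->]]]] /=.
rewrite Eg -[b]mul1r -l1 mulr_suml.
have -> : \sum_j w 0 j * (\sum_i l i *: x i) 0 j = \sum_i l i * \sum_j w 0 j * x i 0 j.
  under eq_bigr do rewrite summxE mulr_sumr.
  rewrite exchange_big; apply: eq_bigr => i _; rewrite mulr_sumr.
  by apply: eq_bigr => j _; rewrite mxE mulrCA.
rewrite -big_split big1// => i _ /=; rewrite -mulrDr -Eg.
by have -> := X0 _ (Xx i); rewrite mulr0.
Qed.

(** Around [y] the set [X] fills the zero hyperplane of [g], which is therefore its affine hull. The
    direction is the kernel of the nonzero linear part [phi] of [g], and rank-nullity gives its
    dimension. *)
Lemma has_codim_hyperplane X g y : affine_function g -> (exists z, g z != 0) ->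
  X `<=` [set x | g x = 0] -> X y ->
  (forall z, g z = 0 -> exists2 e, 0 < e & X (y + e *: (z - y))) -> has_codim X 1.
Proof.
move=> ag [z0 gz0] X0 Xy HX.
have hullE : affine_hull X = [set x | g x = 0].
  apply/seteqP; split; first exact: affine_hull_zero.
  by move=> z /HX[e e0 Xe]; exact: affine_hull_segment Xe.
have [w [b Eg]] := ag.
pose phi : 'Hom('rV[R]_n, 'rV[R]_1) := linfun (mulmxr w^T).
have phiE v : phi v = (\sum_j w 0 j * v 0 j)%:M.
  rewrite lfunE /=; apply/rowP => i; rewrite !mxE ord1 eqxx mulr1n.
  by apply: eq_bigr => j _; rewrite mxE mulrC.
have gB x : g x - g y = \sum_j w 0 j * (x - y) 0 j.
  rewrite !Eg opprD addrACA subrr addr0 -sumrB.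
  by apply: eq_bigr => j _; rewrite !mxE mulrBr.
have gy : g y = 0 := X0 _ Xy.
have kerE x : (x - y \in lker phi) = (g x == 0).
  rewrite memv_ker phiE -gB gy subr0; apply/eqP/eqP => [/rowP/(_ 0)|->].
    by rewrite !mxE eqxx mulr1n.
  by apply/rowP => i; rewrite !mxE mul0rn.
exists y, (lker phi); split.
  rewrite hullE; apply/seteqP; split=> x /=; first by rewrite kerE => ->.
  by rewrite kerE => /eqP.
have := limg_ker_dim phi fullv; rewrite capfv dimv_rV => dimE.
rewrite -[RHS]dimE; congr addn; apply/esym.
apply/eqP; rewrite eqn_leq; apply/andP; split.
  by have := dimvS (subvf (limg phi)); rewrite dimv_rV.
rewrite lt0n dimv_eq0; apply/negP => /eqP lim0.
have : phi (z0 - y) \in limg phi by rewrite memv_img ?memvf.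
by rewrite lim0 memv0 -memv_ker kerE (negbTE gz0).
Qed.

Lemma affine_hull_codim1 X : has_codim X 1 -> exists z, ~ affine_hull X z.
Proof.
move=> [x0 [W [hullE dimW]]]; apply: contrapT => /forallNP all.
have : W = fullv.
  apply/vspaceP => v; rewrite memvf.
  have : affine_hull X (v + x0) by apply: contrapT; exact: all.
  by rewrite hullE /= addrK.
by move=> WE; move: dimW; rewrite WE dimv_rV addn1 => /eqP; rewrite eqn_leq ltnn.
Qed.

End Codimension.

(* The coefficient of x^p in (1 + x)^-d (1 + x)^(d + e). *)
Lemma sum_negative_binomial d p e :
  \sum_(0 <= j < p.+1)
    (-1) ^+ (p - j) * ('C((d + p - j).-1, p - j))%:Z * ('C(d + e, j))%:Z
  = ('C(e, p))%:Z.
Proof.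
elim: d p e => [|d IHd] p e.
  rewrite big_nat_recr//= big_nat_cond big1 ?add0r => [|j /andP[/andP[_ jp] _]].
    by rewrite add0n subnn !mul1r add0n.
  by rewrite bin_small ?mulr0 ?mul0r//; lia.
elim: p e => [|p IHp] e; first by rewrite big_nat1 subnn !bin0 !mulr1.
(* Since (1 + x)^-d = (1 + x) (1 + x)^-(d + 1), the sum for d, p + 1, e + 1 splits into those for d
   + 1, p + 1, e and d + 1, p, e, termwise by Pascal's rule. *)
have := IHd p.+1 e.+1; have := IHp e.
rewrite binS PoszD -(addSnnS d e) => <- E; apply: (addIr (\sum_(0 <= j < p.+1)
    (-1) ^+ (p - j) * ('C((d.+1 + p - j).-1, p - j))%:Z * ('C(d.+1 + e, j))%:Z)).
rewrite -{}E [in LHS]big_nat_recr// [in RHS]big_nat_recr//= addrAC.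
congr (_ + _); last by rewrite !subnn !bin0.
rewrite -big_split; apply: eq_big_nat => j /andP[_ jp] /=.
rewrite subSn// exprS -mulrDl; congr (_ * _).
have -> : (d.+1 + p.+1 - j).-1 = (d + (p - j)).+1 by lia.
have -> : (d.+1 + p - j).-1 = (d + (p - j))%N by lia.
have -> : (d + p.+1 - j).-1 = (d + (p - j))%N by lia.
by rewrite binS PoszD; ring.
Qed.

(** * Atoms and regions of a maxout arrangement *)

Section MaxoutArrangement.
Variables (R : realType) (n m : nat) (k : 'I_m -> nat).
Variable A : forall i : 'I_m, 'I_(k i) -> 'rV[R]_n -> R.
Hypothesis hA : forall i (a : 'I_(k i)), affine_function (A a).

Let affA i (a : 'I_(k i)) : affine (A a) := affine_function_affine (hA a).

Lemma maxout_faceE i (a b : 'I_(k i)) :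
  maxout_face A a b = [set x | A a x = A b x /\ is_max (A (i := i)) x a].
Proof.
apply/seteqP; split=> x /= [Eab].
  by move=> Eb; split=> // c; rewrite Eab Eb; exact: le_bigmax.
move=> maxa; split=> //; rewrite -Eab; apply/eqP; rewrite eq_le; apply/andP; split.
  exact: bigmax_ge_id.
by apply: bigmax_le.
Qed.

(** Codimension 1 excludes faces of two equal pieces away from bends, as these have full affine
    hull. Conversely, a bend may lie on a face of higher codimension, but [bend_facet] finds a pair
    whose face through it has codimension 1. *)
Lemma bigcup_unit_atoms i : \bigcup_(H in unit_atoms A i) H = bend (A (i := i)).
Proof.
apply/seteqP; split=> x.
  move=> [_ [a [b [ab -> cod1]]]]; rewrite maxout_faceE => -[Eab maxa].
  have [fab|fab] := pselect (A a = A b); last by exists a, b.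
  apply: contrapT => nbend; have [z] := affine_hull_codim1 cod1; apply.
  (* Here [A a = A b], and near [x] only functions equal to [A a] are maximal. *)
  have tie (c : 'I_(k i)) : A c x = A a x -> A c = A a.
    by move=> Ec; apply: contrapT => nc; apply: nbend; exists a, c; split=> // /esym.
  have [e e0 He] := alg_open_keep_order (@affA i) (z - x) (x := x) (fun _ _ => id).
  have face y : keep_order (A (i := i)) x y -> maxout_face A a b y.
    rewrite maxout_faceE fab => yB; split=> // c.
    have := maxa c; rewrite fab le_eqVlt => /orP[/eqP Ec|/yB/ltW//].
    by rewrite -fab (tie c) // fab.
  apply: (affine_hull_segment e0 (y := x)); first exact: face.
  by apply: face; apply: He; rewrite lexx ltW.
move=> /(bend_facet (@affA i))[p [q [npq pqx maxx [y [pqy maxy tie]]]]].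
exists (maxout_face A p q); last by rewrite maxout_faceE.
exists p, q; split=> //; first by apply/eqP => pq; apply: npq; rewrite pq.
pose g z := A p z - A q z.
apply: (has_codim_hyperplane (g := g) (y := y)).
- exact: affine_functionB.
- apply: contrapT => ng; apply: npq; apply/funext => z; apply/eqP.
  by rewrite -subr_eq0; apply/negPn/negP => gz; apply: ng; exists z.
- by rewrite maxout_faceE => z [pqz _] /=; rewrite /g pqz subrr.
- by rewrite maxout_faceE.
(* Within the hyperplane, pieces tied with [p] at [y] stay tied and the others stay below near [y],
   so the face fills the hyperplane there. *)
move=> z /eqP; rewrite subr_eq0 => /eqP pqz.
have [e e0 He] := alg_open_keep_order (@affA i) (z - y) (x := y) (fun _ _ => id).
exists e => //; rewrite maxout_faceE.
have {}He := He e _; split.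
  by rewrite !(affine_segment _ _ _ (affA _)) pqy pqz.
move=> d; have := maxy d; rewrite le_eqVlt => /orP[/eqP Ed|/He dp]; last first.
  by apply: ltW; apply: dp; rewrite lexx ltW.
by rewrite !(affine_segment _ _ _ (affA _)) Ed (tie d Ed z pqz).
Qed.

Lemma arrangement_complE (S : {set 'I_m}) :
  arrangement_compl (arrangement A S) =
  [set x | forall i, i \in S -> ~ bend (A (i := i)) x].
Proof.
apply/seteqP; split=> x.
  move=> nx i iS; rewrite -bigcup_unit_atoms => -[H Hi Hx]; apply: nx.
  by exists H => //; exists i.
move=> nx [H [i iS Hi] Hx]; apply: (nx i iS); rewrite -bigcup_unit_atoms.
by exists H.
Qed.

Definition piece_pair := {i : 'I_m & ('I_(k i) * 'I_(k i))%type}.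

Definition piece_diff (t : piece_pair) x := A (tagged t).1 x - A (tagged t).2 x.

Lemma affine_function_piece_diff t : affine_function (piece_diff t).
Proof. exact: affine_functionB. Qed.

(** Only inequalities strict at [x] are recorded: where a unit does not bend, a piece tied with the
    maximal one equals it as a function. *)
Definition dominates (S : {set 'I_m}) x (t : piece_pair) :=
  [/\ tag t \in S, is_max (A (i := tag t)) x (tagged t).1 & 0 < piece_diff t x].

Definition region_of S x : set 'rV[R]_n :=
  [set y | forall t, dominates S x t -> 0 < piece_diff t y].

Hypothesis hk : forall i, (0 < k i)%N.

Lemma region_of_compl (S : {set 'I_m}) x :
  arrangement_compl (arrangement A S) x ->
  region_of S x `<=` arrangement_compl (arrangement A S).
Proof.
rewrite !arrangement_complE => nx y Qy i iS [c [d [ncd Ecd maxc]]].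
have [a maxa] := exists_max (@A i) x (Ordinal (hk i)).
have same (e : 'I_(k i)) : A e y = A c y -> A e = A a.
  move=> Eec; apply: contrapT => nea; apply: (nx i iS); exists a, e; split=> //.
    by move=> /esym.
  apply/eqP; rewrite eq_le (maxa e) andbT leNgt; apply/negP => ltx.
  have := Qy (Tagged (fun i => ('I_(k i) * 'I_(k i))%type) (a, e)).
  rewrite /dominates /piece_diff /= !subr_gt0 => /(_ (And3 iS maxa ltx)).
  by rewrite Eec ltNge maxc.
by apply: ncd; rewrite (same c)// (same d).
Qed.

Lemma seg_convex_region_of S x : seg_convex (region_of S x).
Proof.
move=> y z s Qy Qz sI t dt; apply: (seg_convex_pos _ (Qy t dt) (Qz t dt) sI).
exact: affine_function_affine (affine_function_piece_diff t).
Qed.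

Lemma alg_open_region_of S x : alg_open (region_of S x).
Proof.
apply: alg_open_forall => t; apply: alg_open_impl => _; apply: alg_open_pos.
exact: affine_function_affine (affine_function_piece_diff t).
Qed.

(** Within the complement, the weak inequalities already imply the strict ones, since an equality
    would make two different pieces tie for the maximum. So the convex set [region_of S x] is open
    and closed there. *)
Lemma connected_component_region_of S x :
  arrangement_compl (arrangement A S) x ->
  connected_component (arrangement_compl (arrangement A S)) x = region_of S x.
Proof.
move=> Cx; have QC := region_of_compl Cx.
apply: (connected_component_clopen (O := region_of S x)
  (F := \bigcap_(t in dominates S x) [set y | 0 <= piece_diff t y])).
- exact/seg_convex_connected/seg_convex_region_of.
- by move=> t [].
- rewrite openE => y Qy; apply: (@filter_forall _ _ (fun t => [set z |
      dominates S x t -> 0 < piece_diff t z]) (nbhs y) _) => t.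
  have [dt|ndt] := pselect (dominates S x t); last first.
    by apply: filterS (@filterT _ (nbhs y) _) => z _ /ndt.
  have := open_affine_pos (affine_function_piece_diff t); rewrite openE => /(_ y (Qy t dt)).
  by apply: (@filterS _ (nbhs y)) => z pz _.
- by apply: (@closed_bigI _ _ (dominates S x)) => t _; apply: closed_affine_ge0; exact: affine_function_piece_diff.
- by apply/setIidPr.
apply/seteqP; split=> y; last first.
  by move=> Qy; split; [exact: QC|move=> t /Qy/ltW].
move=> [Cy Fy] [i [a b]] dab; have := Fy _ dab; case: dab => /= iS maxa.
rewrite /piece_diff /= => ltx Fab; rewrite lt_def Fab andbT.
move: Cx Cy; rewrite !arrangement_complE => /(_ i iS) nx /(_ i iS) ny.
apply/eqP => /eqP; rewrite subr_eq0 => /eqP Eab; apply: ny; exists a, b.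
split=> //; first by move=> ab; move: ltx; rewrite ab subrr ltxx.
move=> c; have [Ec|nc] := eqVneq (A c x) (A a x).
  suff -> : A c = A a by [].
  by apply: contrapT => nca; apply: nx; exists a, c; split=> // /esym.
have := Fy (Tagged (fun i => ('I_(k i) * 'I_(k i))%type) (a, c)).
rewrite /dominates /piece_diff /= !subr_ge0; apply; split=> //.
by rewrite subr_gt0 lt_def eq_sym nc maxa.
Qed.

(** The cells cut by the differences of all units refine the regions of every sub-arrangement, so
    one list [L] serves all [S]. *)
Lemma num_regions_maxout : exists L : seq (int * 'rV[R]_n), forall S : {set 'I_m},
  (num_regions (arrangement A S))%:Z =
  \sum_(c <- L) c.1 * (S \subset [set i | ~~ `[< bend (A (i := i)) c.2 >]]%SET)%:R.
Proof.
exists (weighted_cells piece_diff (enum {: piece_pair}) 1 setT) => S.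
rewrite (num_regions_weighted (L := weighted_cells piece_diff (enum {: piece_pair}) 1 setT)).
  apply: eq_bigr => c _; congr (_ * _%:R); congr nat_of_bool.
  rewrite arrangement_complE; apply/idP/fintype.subsetP.
    by move=> /set_mem nx i /nx nb; rewrite !inE; apply/asboolPn.
  by move=> nx; apply: mem_set => i /nx; rewrite !inE => /asboolPn.
move=> x Cx; rewrite connected_component_region_of//.
apply: weighted_cells_convex => //.
- by move=> t; exact: affine_function_affine (affine_function_piece_diff t).
- by move=> y z _ _; exists 1.
- exact: seg_convex_region_of.
- exact: alg_open_region_of.
- by exists x; split=> // t [].
move=> y z _ _ sg_yz Qy t /Qy.
by rewrite -(sgr_gt0 (piece_diff t y)) sg_yz ?mem_enum// sgr_gt0.
Qed.

(** One atom through [x] for each bending unit gives a nonempty intersection, whose codimension is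
    the number of these units by general position. *)
Lemma card_bend x : simple_arrangement A ->
  (#|[set i | `[< bend (A (i := i)) x >]]%SET| <= n)%N.
Proof.
set S := [set i | _]%SET => simpleA.
have atoms i : exists H, i \in S -> unit_atoms A i H /\ H x.
  have [|nS] := boolP (i \in S); last by exists set0.
  rewrite inE => /asboolP; rewrite -bigcup_unit_atoms => -[H Hi Hx].
  by exists H.
have /choice[H HS] := atoms.
have [|cap0|[x0 [W [_ <-]]]] := simpleA S H; last exact: leq_addl.
- by move=> i /HS[].
- have : (\bigcap_(i in [set` S]) H i) x by move=> i /HS[].
  by rewrite cap0.
Qed.

End MaxoutArrangement.

(** * The counting formula, one sample point at a time *)

Theorem theorem6p2 (R : realType) (n m : nat) (k : 'I_m -> nat)
    (A : forall i : 'I_m, 'I_(k i) -> 'rV[R]_n -> R)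
    (hm : (n.+1 <= m)%N)
    (hk : forall i : 'I_m, (2 <= k i)%N)
    (hA : forall (i : 'I_m) (a : 'I_(k i)), affine_function (A i a))
    (hsimple : simple_arrangement A) :
  (num_regions (arrangement A [set: 'I_m]%SET))%:Z =
  \sum_(0 <= j < n.+1)
     (-1) ^+ (n - j) * ('C(m - 1 - j, n - j))%:Z *
     \sum_(S : {set 'I_m} | #|S| == j) (num_regions (arrangement A S))%:Z.
Proof.
have hk0 i : (0 < k i)%N := ltnW (hk i).
have [L HL] := num_regions_maxout hA hk0.
under eq_bigr do (under eq_bigr do rewrite HL; rewrite exchange_big mulr_sumr).
rewrite HL exchange_big; apply: eq_bigr => -[w x] _ /=.
set U := [set i | _]%SET.
have cardU : (m <= #|U| + n)%N.
  have := card_bend hA x hsimple; set B := [set i | _]%SET.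
  have -> : U = ~: B by apply/setP => i; rewrite !inE.
  by have := cardsC B; rewrite card_ord; lia.
have Um : (#|U| <= m)%N by have := max_card (mem U); rewrite card_ord.
have draws j : \sum_(S : {set 'I_m} | #|S| == j) w * (S \subset U)%:R =
    w * ('C(#|U|, j))%:Z.
  rewrite -mulr_sumr -cards_draws; congr (_ * _).
  rewrite -sum1_card -natz natr_sum big_mkcond [RHS]big_mkcond.
  by apply: eq_bigr => S _; rewrite inE andbC; case: eqP; case: (_ \subset _).
under eq_bigr do rewrite draws mulrCA.
rewrite -mulr_sumr; congr (_ * _).
(* The binomial identity applies with d = m - n and e = #|U| + n - m, so that d + e = #|U|. Its
   value ['C(e, n)] is 1 if [U] is everything, as e = n, and 0 otherwise, as e < n. *)
have Em : #|U| = ((m - n) + (#|U| + n - m))%N by lia.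
transitivity ('C(#|U| + n - m, n))%:Z.
  rewrite finset.subTset; have [UT|nUT] := eqVneq U [set: 'I_m]%SET.
    by rewrite UT cardsT card_ord addKn binn.
  rewrite bin_small//; suff : (#|U| < m)%N by lia.
  rewrite ltn_neqAle Um andbT; apply/negP => /eqP cU.
  by move/negP: nUT; apply; rewrite eqEcard finset.subsetT cardsT card_ord cU leqnn.
rewrite -(sum_negative_binomial (m - n)); apply: eq_big_nat => j /andP[_ jn].
by rewrite -Em (_ : (m - n + n - j).-1 = m - 1 - j)%N//; lia.
Qed.
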